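(* Let $\theta^0_1,\theta^0_2,\theta^\infty_1,\theta^\infty_2,\theta^\infty_3\in\mathbb{C}$ with $\theta^0_1+\theta^0_2+\theta^\infty_1+\theta^\infty_2+\theta^\infty_3=0$, $\theta^0_1\ne0$ and $\theta^\infty_1\neq\theta^\infty_2$. Let $q_1,p_1,q_2,p_2,u,v$ be holomorphic functions of $t$ on a domain of $\mathbb{C}\setminus\{0\}$, with $q_1,q_2,u,v\ne0$. Put $$\hat A_\infty=\begin{pmatrix}-1\\ p_1q_1\\ p_2q_2\end{pmatrix}(1,0,0),\quad \hat A_0^{(-1)}=\begin{pmatrix}1\\ 0\\ 0\end{pmatrix}\left(t,\,\frac t{q_1},\,\frac t{q_2}\right),$$ $$\hat A_0^{(0)}=\begin{pmatrix}-p_1q_1-p_2q_2-\theta^\infty_3&-1&-1\\ q_1(p_1q_1-\theta^0_1-\theta^\infty_2)&p_1q_1-\theta^\infty_2&p_1q_1\\ q_2(p_2q_2-\theta^\infty_1)&q_2(p_2q_2-\theta^\infty_1)/q_1&p_2q_2-\theta^\infty_1\end{pmatrix},$$ $$R=\begin{pmatrix}1&0&0\\ -p_1q_1&1&0\\ -p_2q_2&\frac{p_2q_2(q_1-q_2)+\theta^\infty_1q_2}{(\theta^\infty_2-\theta^\infty_1)q_1}&1\end{pmatrix},\qquad G=R\,\mathrm{diag}(1,u,v).$$ Consider the linear systems $$\frac{\partial Y}{\partial x}=AY,\quad A=G^{-1}\left(\frac{\hat A_0^{(-1)}}{x^2}+\frac{\hat A_0^{(0)}}{x}+\hat A_\infty\right)G,\qquad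 \frac{\partial Y}{\partial t}=BY,\quad B=-\frac1{tx}G^{-1}\hat A_0^{(-1)}G .$$ Then the compatibility condition $\partial_tA-\partial_xB+[A,B]=O$ (for all $x$) is equivalent to the Hamiltonian system $\frac{dq_i}{dt}=\frac{\partial H}{\partial p_i}$, $\frac{dp_i}{dt}=-\frac{\partial H}{\partial q_i}$ $(i=1,2)$ with $$tH=tH_{\mathrm{III}}(D_6)\left(-\theta^0_1-\theta^\infty_2,\theta^\infty_3-\theta^\infty_2;t;q_1,p_1\right)+tH_{\mathrm{III}}(D_6)\left(-\theta^\infty_1,\theta^\infty_3-\theta^\infty_1;t;q_2,p_2\right)+p_1q_2\left\{p_2(q_1+q_2)-\theta^\infty_1\right\},$$ together with $$\frac{tq_1}{u}\frac{du}{dt}=q_2(p_2q_2-\theta^\infty_1)+t,\qquad \frac1v\frac{dv}{dt}=\frac1{q_2}.$$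
   Context: $tH_{\mathrm{III}}(D_6)(\alpha,\beta;t;q,p)=p^2q^2-(q^2-\beta q-t)p-\alpha q$ defines the Hamiltonian of the third Painlevé equation of type $D_6$. The Hamiltonian $H$ is that of the degenerate Fuji–Suzuki system of type $A_3$; the linear system has irregular singularities at $x=0,\infty$, of spectral type $(11)(1),(11)(1)$. *)

(* Defs.v *)
From HB Require Import structures.
From mathcomp Require Import all_boot all_order all_algebra.
From mathcomp Require Import complex.
From mathcomp Require Import boolp classical_sets reals topology normedtype.
From mathcomp Require Import derive.

Set Implicit Arguments.
Unset Strict Implicit.
Unset Printing Implicit Defensive.

Import Order.TTheory GRing.Theory Num.Theory numFieldNormedType.Exports.

Local Open Scope classical_set_scope.
Local Open Scope ring_scope.

(* Everything is stated over an abstract numFieldType K, where topological and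
   normed structures are inferred automatically, and is meant to be used at
   K := R[i] with R : realType.  There [derivable _ _ 1] and [derive1] refer to
   the limit of the difference quotient along complex increments, i.e. to
   complex differentiability and the complex derivative. *)
Section Analysis.
Variable K : numFieldType.

Definition is_domain (D : set K) := [/\ D !=set0, open D & connected D].

(* Complex differentiability at every point; the right notion for open D. *)
Definition holomorphic_on (D : set K) (f : K -> K) :=
  forall z, D z -> derivable f z 1.

Definition derive1mx m n (M : K -> 'M[K]_(m, n)) (a : K) : 'M[K]_(m, n) :=
  \matrix_(i, j) derive1 (fun s => M s i j) a.

Definition zero_curvature (D : set K) (A B : K -> K -> 'M[K]_3) :=
  forall t x, D t -> x != 0 ->
    derive1mx (fun s => A s x) t - derive1mx (fun y => B t y) x
    + (A t x *m B t x - B t x *m A t x) = 0.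

Definition hamiltonian_system (D : set K) (H : K -> K -> K -> K -> K -> K)
    (q1 p1 q2 p2 : K -> K) :=
  forall t, D t ->
    [/\ derive1 q1 t = derive1 (fun p => H t (q1 t) p (q2 t) (p2 t)) (p1 t),
        derive1 p1 t = - derive1 (fun q => H t q (p1 t) (q2 t) (p2 t)) (q1 t),
        derive1 q2 t = derive1 (fun p => H t (q1 t) (p1 t) (q2 t) p) (p2 t) &
        derive1 p2 t = - derive1 (fun q => H t (q1 t) (p1 t) q (p2 t)) (q2 t)].

Definition gauge_equations (D : set K) (thi1 : K) (q1 q2 p2 u v : K -> K) :=
  forall t, D t ->
    t * q1 t / u t * derive1 u t = q2 t * (p2 t * q2 t - thi1) + t /\
    1 / v t * derive1 v t = 1 / q2 t.

End Analysis.

Section LaxPair.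
Variable K : fieldType.

Definition mx3 (rows : seq (seq K)) : 'M[K]_3 := \matrix_(i, j) (nth [::] rows i)`_j.
Definition col3 (s : seq K) : 'cV[K]_3 := \col_i s`_i.
Definition row3 (s : seq K) : 'rV[K]_3 := \row_j s`_j.

(* th01 and thi1, thi2, thi3 stand for theta^0_1 and theta^infty_1,
   theta^infty_2, theta^infty_3; theta^0_2 does not occur in the formulas. *)
Variables (th01 thi1 thi2 thi3 : K).

Definition hatAinf (q1 p1 q2 p2 : K) : 'M[K]_3 :=
  col3 [:: -1; p1 * q1; p2 * q2] *m row3 [:: 1; 0; 0].

Definition hatA0m1 (t q1 q2 : K) : 'M[K]_3 :=
  col3 [:: 1; 0; 0] *m row3 [:: t; t / q1; t / q2].

Definition hatA00 (q1 p1 q2 p2 : K) : 'M[K]_3 :=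
  mx3 [:: [:: - p1 * q1 - p2 * q2 - thi3; -1; -1];
          [:: q1 * (p1 * q1 - th01 - thi2); p1 * q1 - thi2; p1 * q1];
          [:: q2 * (p2 * q2 - thi1); q2 * (p2 * q2 - thi1) / q1;
              p2 * q2 - thi1]].

Definition gaugeR (q1 p1 q2 p2 : K) : 'M[K]_3 :=
  mx3 [:: [:: 1; 0; 0];
          [:: - (p1 * q1); 1; 0];
          [:: - (p2 * q2);
              (p2 * q2 * (q1 - q2) + thi1 * q2) / ((thi2 - thi1) * q1); 1]].

Definition gaugeG (q1 p1 q2 p2 u v : K) : 'M[K]_3 :=
  gaugeR q1 p1 q2 p2 *m diag_mx (row3 [:: 1; u; v]).

Definition laxA (q1 p1 q2 p2 u v : K -> K) (t x : K) : 'M[K]_3 :=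
  let G := gaugeG (q1 t) (p1 t) (q2 t) (p2 t) (u t) (v t) in
  invmx G *m ((x ^+ 2)^-1 *: hatA0m1 t (q1 t) (q2 t)
              + x^-1 *: hatA00 (q1 t) (p1 t) (q2 t) (p2 t)
              + hatAinf (q1 t) (p1 t) (q2 t) (p2 t)) *m G.

Definition laxB (q1 p1 q2 p2 u v : K -> K) (t x : K) : 'M[K]_3 :=
  let G := gaugeG (q1 t) (p1 t) (q2 t) (p2 t) (u t) (v t) in
  - (1 / (t * x)) *: (invmx G *m hatA0m1 t (q1 t) (q2 t) *m G).

(* t times the Hamiltonian of the third Painleve equation of type D_6 *)
Definition tHIIID6 (alpha beta t q p : K) : K :=
  p ^+ 2 * q ^+ 2 - (q ^+ 2 - beta * q - t) * p - alpha * q.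

Definition tHam (t q1 p1 q2 p2 : K) : K :=
  tHIIID6 (- th01 - thi2) (thi3 - thi2) t q1 p1
  + tHIIID6 (- thi1) (thi3 - thi1) t q2 p2
  + p1 * q2 * (p2 * (q1 + q2) - thi1).

Definition Ham (t q1 p1 q2 p2 : K) : K := tHam t q1 p1 q2 p2 / t.

End LaxPair.

(* Main.v *)
Require Import Defs.
From HB Require Import structures.
From mathcomp Require Import all_boot all_order all_algebra.
From mathcomp Require Import complex.
From mathcomp Require Import boolp classical_sets reals topology normedtype.
From mathcomp Require Import derive.
From mathcomp Require Import ring.

Set Implicit Arguments.
Unset Strict Implicit.
Unset Printing Implicit Defensive.

Import Order.TTheory GRing.Theory Num.Theory numFieldNormedType.Exports.

Local Open Scope classical_set_scope.
Local Open Scope ring_scope.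

(** The gauge matrix G brings the three coefficients of A to a normal form:
    the leading one at infinity becomes the constant matrix C = - E11, the
    residue at 0 becomes a matrix L whose diagonal is constant and whose lower
    right block is diagonal, and the double pole becomes t N, where
    N = a b is the product of a column a with first entry 1 and a row b.
    Hence A = t N / x^2 + L / x + C and B = - N / x, and expanding in powers
    of 1/x the zero-curvature condition says exactly that
    t N' = [L, N] and L' = [C, N] ([curvature_expansion], [flat_iff]).

    The entries of a, b and L are explicit rational functions of the point
    (q1, p1, q2, p2, u, v), so at each time these matrix equations are affine
    in the six derivatives.  The Hamiltonian vector field, completed by the two
    gauge equations, is a solution: for N this splits into the two equations
    t a' = L a - lam a and t b' = lam b - b L, where lam is the first entry of
    L a ([poleCoef_flow], [residue_flow]).  It is the only one because the map
    from the point to (N, L) is an immersion ([normal_form_immersion]); the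
    last step of that argument is where theta^0_1 must not vanish.  So at each t
    both sides of the equivalence say that the derivative of the point is the
    vector field [hamField] ([flow_unique], [hamField_iff]). *)

(** * Matrices of size three given by their entries *)

Section ExplicitMatrices.
Variable K : fieldType.

Lemma mx3_mul (a11 a12 a13 a21 a22 a23 a31 a32 a33
               b11 b12 b13 b21 b22 b23 b31 b32 b33 : K) :
  mx3 [:: [:: a11; a12; a13]; [:: a21; a22; a23]; [:: a31; a32; a33]]
  *m mx3 [:: [:: b11; b12; b13]; [:: b21; b22; b23]; [:: b31; b32; b33]]
  = mx3 [:: [:: a11 * b11 + a12 * b21 + a13 * b31;
                a11 * b12 + a12 * b22 + a13 * b32;
                a11 * b13 + a12 * b23 + a13 * b33];
            [:: a21 * b11 + a22 * b21 + a23 * b31;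
                a21 * b12 + a22 * b22 + a23 * b32;
                a21 * b13 + a22 * b23 + a23 * b33];
            [:: a31 * b11 + a32 * b21 + a33 * b31;
                a31 * b12 + a32 * b22 + a33 * b32;
                a31 * b13 + a32 * b23 + a33 * b33]].
Proof.
apply/matrixP => i j; rewrite mxE !big_ord_recr big_ord0 /= add0r !mxE /=.
by case: i => [[|[|[|//]]] ?]; case: j => [[|[|[|//]]] ?].
Qed.

Lemma col3_mul_row3 (a1 a2 a3 b1 b2 b3 : K) :
  col3 [:: a1; a2; a3] *m row3 [:: b1; b2; b3]
  = mx3 [:: [:: a1 * b1; a1 * b2; a1 * b3]; [:: a2 * b1; a2 * b2; a2 * b3];
            [:: a3 * b1; a3 * b2; a3 * b3]].
Proof.
apply/matrixP => i j; rewrite mxE big_ord1 !mxE.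
by case: i => [[|[|[|//]]] ?]; case: j => [[|[|[|//]]] ?].
Qed.

Lemma mx3_mul_diag (a11 a12 a13 a21 a22 a23 a31 a32 a33 d1 d2 d3 : K) :
  mx3 [:: [:: a11; a12; a13]; [:: a21; a22; a23]; [:: a31; a32; a33]]
  *m diag_mx (row3 [:: d1; d2; d3])
  = mx3 [:: [:: a11 * d1; a12 * d2; a13 * d3]; [:: a21 * d1; a22 * d2; a23 * d3];
            [:: a31 * d1; a32 * d2; a33 * d3]].
Proof.
apply/matrixP => i j; rewrite mul_mx_diag !mxE.
by case: i => [[|[|[|//]]] ?]; case: j => [[|[|[|//]]] ?].
Qed.

Lemma mx3_scale c (a11 a12 a13 a21 a22 a23 a31 a32 a33 : K) :
  c *: mx3 [:: [:: a11; a12; a13]; [:: a21; a22; a23]; [:: a31; a32; a33]]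
  = mx3 [:: [:: c * a11; c * a12; c * a13]; [:: c * a21; c * a22; c * a23];
            [:: c * a31; c * a32; c * a33]].
Proof.
apply/matrixP => i j; rewrite !mxE.
by case: i => [[|[|[|//]]] ?]; case: j => [[|[|[|//]]] ?].
Qed.

Lemma mx3_sub (a11 a12 a13 a21 a22 a23 a31 a32 a33
               b11 b12 b13 b21 b22 b23 b31 b32 b33 : K) :
  mx3 [:: [:: a11; a12; a13]; [:: a21; a22; a23]; [:: a31; a32; a33]]
  - mx3 [:: [:: b11; b12; b13]; [:: b21; b22; b23]; [:: b31; b32; b33]]
  = mx3 [:: [:: a11 - b11; a12 - b12; a13 - b13];
            [:: a21 - b21; a22 - b22; a23 - b23];
            [:: a31 - b31; a32 - b32; a33 - b33]].
Proof.
apply/matrixP => i j; rewrite !mxE.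
by case: i => [[|[|[|//]]] ?]; case: j => [[|[|[|//]]] ?].
Qed.

Lemma mx3_add (a11 a12 a13 a21 a22 a23 a31 a32 a33
               b11 b12 b13 b21 b22 b23 b31 b32 b33 : K) :
  mx3 [:: [:: a11; a12; a13]; [:: a21; a22; a23]; [:: a31; a32; a33]]
  + mx3 [:: [:: b11; b12; b13]; [:: b21; b22; b23]; [:: b31; b32; b33]]
  = mx3 [:: [:: a11 + b11; a12 + b12; a13 + b13];
            [:: a21 + b21; a22 + b22; a23 + b23];
            [:: a31 + b31; a32 + b32; a33 + b33]].
Proof.
apply/matrixP => i j; rewrite !mxE.
by case: i => [[|[|[|//]]] ?]; case: j => [[|[|[|//]]] ?].
Qed.

Definition mx3E := (mx3_mul_diag, mx3_mul, col3_mul_row3, mx3_scale, mx3_sub, mx3_add).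

Lemma mx3_inj (a11 a12 a13 a21 a22 a23 a31 a32 a33
               b11 b12 b13 b21 b22 b23 b31 b32 b33 : K) :
  mx3 [:: [:: a11; a12; a13]; [:: a21; a22; a23]; [:: a31; a32; a33]]
  = mx3 [:: [:: b11; b12; b13]; [:: b21; b22; b23]; [:: b31; b32; b33]] ->
  [/\ [/\ a11 = b11, a12 = b12 & a13 = b13], [/\ a21 = b21, a22 = b22 & a23 = b23]
    & [/\ a31 = b31, a32 = b32 & a33 = b33]].
Proof.
move=> /matrixP E.
have e (k l : nat) (hk : (k < 3)%N) (hl : (l < 3)%N) := E (Ordinal hk) (Ordinal hl).
split; split;
  [move: (e 0%N 0%N isT isT) | move: (e 0%N 1%N isT isT) | move: (e 0%N 2%N isT isT)
  |move: (e 1%N 0%N isT isT) | move: (e 1%N 1%N isT isT) | move: (e 1%N 2%N isT isT)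
  |move: (e 2%N 0%N isT isT) | move: (e 2%N 1%N isT isT) | move: (e 2%N 2%N isT isT)];
  by rewrite !mxE.
Qed.

Lemma mx3_0 : 0 = mx3 [:: [:: 0; 0; 0]; [:: 0; 0; 0]; [:: 0; 0; 0]] :> 'M[K]_3.
Proof.
apply/matrixP => i j; rewrite !mxE.
by case: i => [[|[|[|//]]] ?]; case: j => [[|[|[|//]]] ?].
Qed.

Definition lie3 (A B : 'M[K]_3) := A *m B - B *m A.

Lemma conj_eq n (G X Y : 'M[K]_n) :
  G \in unitmx -> X *m G = G *m Y -> invmx G *m X *m G = Y.
Proof. by move=> Gu e; rewrite -mulmxA e mulKmx. Qed.

End ExplicitMatrices.

(** * The normal form of the Lax pair *)

(** A point of the phase space extended by the gauge variables; also used for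
    a tangent vector at such a point. *)
Record phase (K : Type) := Phase
  { cq1 : K; cp1 : K; cq2 : K; cp2 : K; cu : K; cv : K }.

Section NormalForm.
Variable K : fieldType.
Variables th01 thi1 thi2 thi3 : K.
Implicit Types (x d : phase K) (t : K).

(** The entry in position (3,2) of the gauge matrix R.  Here and below, the
    prefix d denotes the derivative at x in the direction d. *)
Definition gaugeE x : K :=
  (cp2 x * cq2 x * (cq1 x - cq2 x) + thi1 * cq2 x) / ((thi2 - thi1) * cq1 x).
Definition dgaugeE x d : K :=
  ((cp2 d * cq2 x + cp2 x * cq2 d) * (cq1 x - cq2 x)
   + cp2 x * cq2 x * (cq1 d - cq2 d) + thi1 * cq2 d) / ((thi2 - thi1) * cq1 x)
  - gaugeE x * cq1 d / cq1 x.

Definition poleCol2 x := cp1 x * cq1 x / cu x.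
Definition dpoleCol2 x d :=
  (cp1 d * cq1 x + cp1 x * cq1 d) / cu x - poleCol2 x * cu d / cu x.
Definition poleCol3 x := (cp2 x * cq2 x - gaugeE x * (cp1 x * cq1 x)) / cv x.
Definition dpoleCol3 x d :=
  (cp2 d * cq2 x + cp2 x * cq2 d - dgaugeE x d * (cp1 x * cq1 x)
   - gaugeE x * (cp1 d * cq1 x + cp1 x * cq1 d)) / cv x - poleCol3 x * cv d / cv x.

Definition poleCol x : 'cV[K]_3 := col3 [:: 1; poleCol2 x; poleCol3 x].
Definition dpoleCol x d : 'cV[K]_3 := col3 [:: 0; dpoleCol2 x d; dpoleCol3 x d].

Definition poleRow x : 'rV[K]_3 :=
  row3 [:: 1 - cp1 x - cp2 x; cu x * (1 / cq1 x + gaugeE x / cq2 x); cv x / cq2 x].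
Definition dpoleRow x d : 'rV[K]_3 :=
  row3 [:: - cp1 d - cp2 d;
    cu d * (1 / cq1 x + gaugeE x / cq2 x)
    + cu x * (- cq1 d / cq1 x ^+ 2 + dgaugeE x d / cq2 x
              - gaugeE x * cq2 d / cq2 x ^+ 2);
    cv d / cq2 x - cv x * cq2 d / cq2 x ^+ 2].

(** The entries (2,1) and (3,1) of the residue at 0 in the gauge R, that is,
    before conjugation by diag(1, u, v), are [residue2] and [residue3]. *)
Definition residue2 x :=
  cq1 x * (cp1 x * cq1 x - th01 - thi2)
  - cp1 x * cq1 x * (cp1 x * cq1 x + cp2 x * cq2 x - thi2 + thi3).
Definition dresidue2 x d :=
  let w1 := cp1 x * cq1 x in let w2 := cp2 x * cq2 x in
  let dw1 := cp1 d * cq1 x + cp1 x * cq1 d in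
  let dw2 := cp2 d * cq2 x + cp2 x * cq2 d in
  cq1 d * (w1 - th01 - thi2) + cq1 x * dw1
  - dw1 * (w1 + w2 - thi2 + thi3) - w1 * (dw1 + dw2).
Definition residue3 x :=
  (cp2 x * cq2 x - thi1) * (cq2 x - cp1 x * cq2 x - cp2 x * cq2 x)
  - cp2 x * cq2 x * thi3 - gaugeE x * residue2 x.
Definition dresidue3 x d :=
  let w2 := cp2 x * cq2 x in
  let dw2 := cp2 d * cq2 x + cp2 x * cq2 d in
  dw2 * (cq2 x - cp1 x * cq2 x - w2)
  + (w2 - thi1) * (cq2 d - (cp1 d * cq2 x + cp1 x * cq2 d) - dw2)
  - dw2 * thi3 - dgaugeE x d * residue2 x - gaugeE x * dresidue2 x d.

Definition residue x : 'M[K]_3 :=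
  mx3 [:: [:: - thi3; - ((1 + gaugeE x) * cu x); - cv x];
          [:: residue2 x / cu x; - thi2; 0];
          [:: residue3 x / cv x; 0; - thi1]].
Definition dresidue x d : 'M[K]_3 :=
  mx3 [:: [:: 0; - (dgaugeE x d * cu x + (1 + gaugeE x) * cu d); - cv d];
          [:: dresidue2 x d / cu x - residue2 x / cu x * cu d / cu x; 0; 0];
          [:: dresidue3 x d / cv x - residue3 x / cv x * cv d / cv x; 0; 0]].

Definition poleCoef x : 'M[K]_3 := poleCol x *m poleRow x.
Definition dpoleCoef x d : 'M[K]_3 :=
  dpoleCol x d *m poleRow x + poleCol x *m dpoleRow x d.

Definition infCoef : 'M[K]_3 := mx3 [:: [:: -1; 0; 0]; [:: 0; 0; 0]; [:: 0; 0; 0]].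

(** The right-hand sides of the Hamiltonian system and of the two gauge
    equations, solved for the derivatives. *)
Definition hamField t x : phase K :=
  let: Phase q1 p1 q2 p2 u v := x in
  Phase
   ((2 * p1 * q1 ^+ 2 - (q1 ^+ 2 - (thi3 - thi2) * q1 - t)
     + q2 * (p2 * (q1 + q2) - thi1)) / t)
   (- (2 * p1 ^+ 2 * q1 - (2 * q1 - (thi3 - thi2)) * p1 + (th01 + thi2)
     + p1 * q2 * p2) / t)
   ((2 * p2 * q2 ^+ 2 - (q2 ^+ 2 - (thi3 - thi1) * q2 - t)
     + p1 * q2 * (q1 + q2)) / t)
   (- (2 * p2 ^+ 2 * q2 - (2 * q2 - (thi3 - thi1)) * p2 + thi1
     + p1 * (p2 * (q1 + q2) - thi1) + p1 * q2 * p2) / t)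
   (u * (q2 * (p2 * q2 - thi1) + t) / (t * q1))
   (v / q2).

Definition gauge x :=
  gaugeG thi1 thi2 (cq1 x) (cp1 x) (cq2 x) (cp2 x) (cu x) (cv x).

Lemma gaugeG_unit x : cu x != 0 -> cv x != 0 -> gauge x \in unitmx.
Proof.
move=> u0 v0; rewrite unitmxE det_mulmx det_diag unitrM; apply/andP; split.
  rewrite det_trig; last first.
    apply/is_trig_mxP => [[[|[|[|//]]] ?] [[|[|[|//]]] ?]] //= _; by rewrite mxE.
  by rewrite !big_ord_recr big_ord0 /= !mxE /= !mulr1 unitr1.
by rewrite !big_ord_recr big_ord0 /= !mxE /= !mul1r unitfE mulf_neq0.
Qed.

Definition regular x := [/\ cq1 x != 0, cq2 x != 0, cu x != 0 & cv x != 0].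
Hypothesis thi_neq : thi2 - thi1 != 0.

(** The conjugations are stated as intertwining relations, which are identities
    between rational functions without the inverse of the gauge matrix. *)
Lemma hatA0m1_gauge t x : regular x ->
  hatA0m1 t (cq1 x) (cq2 x) *m gauge x = gauge x *m (t *: (poleCol x *m poleRow x)).
Proof.
case: x => q1 p1 q2 p2 u v [/= q10 q20 u0 v0].
rewrite /gauge /gaugeG /hatA0m1 /gaugeR /poleCol /poleRow.
rewrite !mx3E /poleCol3 /poleCol2 /gaugeE /=.
congr (mx3 [:: [:: _; _; _]; [:: _; _; _]; [:: _; _; _]]).
all: field; rewrite ?q10 ?q20 ?u0 ?v0 ?thi_neq //.
Qed.

Lemma hatA00_gauge x : regular x ->
  hatA00 th01 thi1 thi2 thi3 (cq1 x) (cp1 x) (cq2 x) (cp2 x) *m gauge x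
  = gauge x *m residue x.
Proof.
case: x => q1 p1 q2 p2 u v [/= q10 q20 u0 v0].
rewrite /gauge /gaugeG /hatA00 /gaugeR /residue.
rewrite !mx3E /residue3 /residue2 /gaugeE /=.
congr (mx3 [:: [:: _; _; _]; [:: _; _; _]; [:: _; _; _]]).
all: field; rewrite ?q10 ?q20 ?u0 ?v0 ?thi_neq //.
Qed.

Lemma hatAinf_gauge x :
  hatAinf (cq1 x) (cp1 x) (cq2 x) (cp2 x) *m gauge x = gauge x *m infCoef.
Proof.
rewrite /gauge /gaugeG /hatAinf /gaugeR /infCoef !mx3E.
congr (mx3 [:: [:: _; _; _]; [:: _; _; _]; [:: _; _; _]]); ring.
Qed.

(** * The Hamiltonian field solves the matrix equations *)

(** The multiplier that keeps the first entry of the column equal to 1 while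
    the column moves along the residue. *)
Definition drift x : K := (residue x *m poleCol x) 0 0.

Lemma poleCol_flow t x : t != 0 -> regular x ->
  t *: dpoleCol x (hamField t x) = residue x *m poleCol x - drift x *: poleCol x.
Proof.
case: x => q1 p1 q2 p2 u v t0 [/= q10 q20 u0 v0].
apply/matrixP => i j.
case: i => [[|[|[|//]]] ?]; rewrite /drift !(mxE, big_ord_recr, big_ord0) /=.
all: rewrite /dpoleCol2 /dpoleCol3 /residue3 /residue2.
all: rewrite /poleCol2 /poleCol3 /dgaugeE /gaugeE /=.
all: field; rewrite ?t0 ?q10 ?q20 ?u0 ?v0 ?thi_neq //.
Qed.

Lemma poleRow_flow t x : t != 0 -> regular x ->
  t *: dpoleRow x (hamField t x) = drift x *: poleRow x - poleRow x *m residue x.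
Proof.
case: x => q1 p1 q2 p2 u v t0 [/= q10 q20 u0 v0].
apply/matrixP => j i.
case: i => [[|[|[|//]]] ?]; rewrite /drift !(mxE, big_ord_recr, big_ord0) /=.
all: rewrite /dpoleCol2 /dpoleCol3 /residue3 /residue2.
all: rewrite /poleCol2 /poleCol3 /dgaugeE /gaugeE /=.
all: field; rewrite ?t0 ?q10 ?q20 ?u0 ?v0 ?thi_neq //.
Qed.

Lemma residue_flow t x : t != 0 -> regular x ->
  dresidue x (hamField t x) = lie3 infCoef (poleCoef x).
Proof.
case: x => q1 p1 q2 p2 u v t0 [/= q10 q20 u0 v0].
rewrite /dresidue /poleCoef /lie3 /poleCol /poleRow /infCoef !mx3E.
congr (mx3 [:: [:: _; _; _]; [:: _; _; _]; [:: _; _; _]]).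
all: rewrite /dresidue3 /dresidue2 /residue3 /residue2.
all: rewrite /poleCol2 /poleCol3 /dgaugeE /gaugeE /=.
all: field; rewrite ?t0 ?q10 ?q20 ?u0 ?v0 ?thi_neq //.
Qed.

(** In the product rule for a b the two drift terms cancel, which leaves the
    commutator with the residue. *)
Lemma poleCoef_flow t x : t != 0 -> regular x ->
  t *: dpoleCoef x (hamField t x) = lie3 (residue x) (poleCoef x).
Proof.
move=> t0 xreg.
rewrite /dpoleCoef scalerDr scalemxAl scalemxAr.
rewrite (poleCol_flow t0 xreg) (poleRow_flow t0 xreg).
rewrite mulmxBl mulmxBr -scalemxAl -scalemxAr addrA subrK.
by rewrite /lie3 /poleCoef !mulmxA.
Qed.

(** * The normal form determines the tangent vector *)

Definition phase_sub d e := Phase (cq1 d - cq1 e) (cp1 d - cp1 e)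
  (cq2 d - cq2 e) (cp2 d - cp2 e) (cu d - cu e) (cv d - cv e).

Lemma dpoleCoef_sub x d e :
  dpoleCoef x (phase_sub d e) = dpoleCoef x d - dpoleCoef x e.
Proof.
rewrite /dpoleCoef /dpoleCol /dpoleRow /poleCol /poleRow !mx3E.
congr (mx3 [:: [:: _; _; _]; [:: _; _; _]; [:: _; _; _]]).
all: rewrite /dpoleCol2 /dpoleCol3 /dgaugeE /=; ring.
Qed.

Lemma dresidue_sub x d e :
  dresidue x (phase_sub d e) = dresidue x d - dresidue x e.
Proof.
rewrite /dresidue !mx3E.
congr (mx3 [:: [:: _; _; _]; [:: _; _; _]; [:: _; _; _]]).
all: rewrite /dresidue3 /dresidue2 /dgaugeE /=; ring.
Qed.

(** The entry - v of the residue gives dv = 0; since a has first entry 1, the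
    first row of N is b, and its outer entries give dq2 = 0 and dp2 = - dp1.
    The second entry of a, and the middle entry of b combined with the entry
    (1,2) of the residue, make dp1, du and dq1 multiples of
    rho = du / u - dq1 / q1.  Now the middle entry of b says (theta^infty_2 - p1 (q1 - q2)) rho = 0, and the entry (2,1)
    of the residue says (theta^0_1 + theta^infty_2 - p1 (q1 - q2)) rho = 0;
    the difference is theta^0_1 rho = 0. *)
Lemma normal_form_immersion x d : th01 != 0 -> regular x ->
  dpoleCoef x d = 0 -> dresidue x d = 0 -> d = Phase 0 0 0 0 0 0.
Proof.
case: x d => q1 p1 q2 p2 u v [dq1 dp1 dq2 dp2 du dv] th010 [/= q10 q20 u0 v0].
rewrite /dpoleCoef /dpoleCol /dpoleRow /poleCol /poleRow /dresidue !mx3E mx3_0.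
move=> /mx3_inj[[+ + +] [_ _ +] _] /mx3_inj[[_ + +] [+ _ _] _].
rewrite /= !mul0r !add0r !mul1r => row1 row2 row3 col2E l12 /eqP.
rewrite oppr_eq0 => /eqP dv0 l21; subst dv.
have {row3} dq20 : dq2 = 0.
  have -> : dq2 = - (q2 ^+ 2 / v) * (0 / q2 - v * dq2 / q2 ^+ 2).
    by field; rewrite q20 v0.
  by rewrite row3 mulr0.
subst dq2.
have {row1} dp2E : dp2 = - dp1 by rewrite -[LHS]addr0 -row1; ring.
subst dp2.
pose rho := du / u - dq1 / q1.
(* The entry (2,3) of dN is da2 b3 + a2 db3, where b3 = v / q2 is invertible
   and db3 is already zero, so da2 = 0. *)
have {col2E} dp1E : dp1 = p1 * rho.
  apply/eqP; rewrite -subr_eq0; apply/eqP.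
  have -> : dp1 - p1 * rho = u * q2 / (v * q1) * (
     dpoleCol2 (Phase q1 p1 q2 p2 u v) (Phase dq1 dp1 0 (- dp1) du 0) * (v / q2) +
     poleCol2 (Phase q1 p1 q2 p2 u v) * (0 / q2 - v * 0 / q2 ^+ 2)).
    by rewrite /dpoleCol2 /poleCol2 /rho /=; field; rewrite q10 q20 u0 v0.
  by rewrite col2E mulr0.
(* In dL12 + q2 db2 the derivative of the gauge entry cancels. *)
have {l12} duE : du = u * q2 / q1 * rho.
  apply/esym/eqP; rewrite -subr_eq0; apply/eqP.
  rewrite -[RHS](mulr0 q2) -row2 -[RHS]addr0 -[X in _ = _ + X]l12 /rho.
  by field; rewrite q10 q20 u0.
have dq1E : dq1 = (q2 - q1) * rho.
  have -> : dq1 = q1 * (du / u - rho) by rewrite /rho; field; rewrite q10 u0.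
  by rewrite duE; field; rewrite q10 u0.
suff rho0 : rho = 0.
  by rewrite dq1E dp1E duE rho0 !mulr0 oppr0.
apply: (mulfI th010); rewrite mulr0.
move: row2 l21; move: {dp1E duE dq1E} rho dp1E duE dq1E => rho -> -> ->.
set row2 := (X in X = 0 -> _) => row20; set l21 := (X in X = 0 -> _) => l210.
(* After the substitutions the two entries are
   db2 = (u / ((thi2 - thi1) q1)) (thi2 - p1 (q1 - q2)) rho, and
   dL21 = (q1 / u) (th01 + thi2 - p1 (q1 - q2)) rho. *)
have -> : th01 * rho = u / q1 * l21 - (thi2 - thi1) * q1 / u * row2.
  rewrite /l21 /row2 /dresidue2 /residue2 /dgaugeE /gaugeE /=.
  by field; rewrite q10 q20 u0 thi_neq.
by rewrite row20 l210 !mulr0 subr0.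
Qed.

(** Both conditions are affine in d, so the difference of two solutions is a
    tangent vector on which the differential of (N, L) vanishes. *)
Lemma flow_unique t x d : th01 != 0 -> t != 0 -> regular x ->
  t *: dpoleCoef x d = lie3 (residue x) (poleCoef x) /\
  dresidue x d = lie3 infCoef (poleCoef x)
  <-> d = hamField t x.
Proof.
move=> th010 t0 xreg; split=> [[Ncond Lcond]|->]; last first.
  by split; [exact: poleCoef_flow | exact: residue_flow].
have : phase_sub d (hamField t x) = Phase 0 0 0 0 0 0.
  apply: (normal_form_immersion th010 xreg).
    apply: (scalerI t0).
    by rewrite dpoleCoef_sub scalerBr Ncond poleCoef_flow // subrr scaler0.
  by rewrite dresidue_sub Lcond residue_flow // subrr.
case: (hamField t x) => ? ? ? ? ? ?; case: d {Ncond Lcond} => ? ? ? ? ? ?.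
by case; do 6!move=> /subr0_eq ->.
Qed.
End NormalForm.

(** * Derivatives along a curve *)

Section Calculus.
Variable K : numFieldType.
Implicit Types (f g : K -> K) (t : K).

(** These differentiation rules are stated for an explicit expression under a
    binder, so that unification can apply them to rational expressions. *)
Lemma is_derive_id_fun t : is_derive t (1 : K) (fun s : K => s) 1.
Proof. exact: is_derive_id. Qed.

Lemma is_derive_cst_fun (c t : K) : is_derive t (1 : K) (fun _ : K => c) 0.
Proof. exact: is_derive_cst. Qed.

Lemma is_derive_add f g t df dg : is_derive t 1 f df -> is_derive t 1 g dg ->
  is_derive t 1 (fun s => f s + g s) (df + dg).
Proof. exact: is_deriveD. Qed.

Lemma is_derive_opp f t df : is_derive t 1 f df ->
  is_derive t 1 (fun s => - f s) (- df).
Proof. exact: is_deriveN. Qed.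

Lemma is_derive_mul f g t df dg : is_derive t 1 f df -> is_derive t 1 g dg ->
  is_derive t 1 (fun s => f s * g s) (f t * dg + g t * df).
Proof. exact: is_deriveM. Qed.

Lemma is_derive_sqr f t df : is_derive t 1 f df ->
  is_derive t 1 (fun s => f s ^+ 2) (2 * f t * df).
Proof.
move=> fd; under eq_fun do rewrite expr2.
notypeclasses refine (is_derive_eq _ _); first exact: (is_derive_mul fd fd).
by ring.
Qed.

Lemma is_derive_inv f t df : f t != 0 -> is_derive t 1 f df ->
  is_derive t 1 (fun s => (f s)^-1) (- df / f t ^+ 2).
Proof.
move=> ft0 [fd fE]; split; first exact: derivableV.
by rewrite deriveV // fE -[_ *: _]/(_ * _) mulrC mulrN mulNr.
Qed.

Definition mx_is_derive m n (t : K) (M : K -> 'M[K]_(m, n)) (M' : 'M[K]_(m, n)) :=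
  forall i j, is_derive t (1 : K) (fun s => M s i j) (M' i j).

End Calculus.

(* As is_derive is a class, instance search would pick derivatives of another
   shape; it is kept out so that the value is built by the rules alone. *)
Ltac derive_rules :=
  repeat first
    [ eassumption
    | notypeclasses refine (is_derive_id_fun _)
    | notypeclasses refine (is_derive_cst_fun _ _)
    | notypeclasses refine (is_derive_opp _)
    | notypeclasses refine (is_derive_add _ _)
    | notypeclasses refine (is_derive_mul _ _)
    | notypeclasses refine (is_derive_sqr _)
    | notypeclasses refine (is_derive_inv _ _) ].

Ltac by_derive_rules :=
  notypeclasses refine (is_derive_eq _ _); first (derive_rules => //); cbv beta.

Section Curves.
Variable K : numFieldType.
Variables th01 thi1 thi2 thi3 : K.
Hypothesis thi_neq : thi2 - thi1 != 0.

Section AlongCurve.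
Variables (X : K -> phase K) (t : K) (d : phase K).
Hypothesis X_regular : regular (X t).
Hypothesis X_derive :
  [/\ [/\ is_derive t 1 (fun s => cq1 (X s)) (cq1 d),
          is_derive t 1 (fun s => cp1 (X s)) (cp1 d),
          is_derive t 1 (fun s => cq2 (X s)) (cq2 d) &
          is_derive t 1 (fun s => cp2 (X s)) (cp2 d)],
      is_derive t 1 (fun s => cu (X s)) (cu d) &
      is_derive t 1 (fun s => cv (X s)) (cv d)].

Lemma is_derive_gaugeE :
  is_derive t 1 (fun s => gaugeE thi1 thi2 (X s)) (dgaugeE thi1 thi2 (X t) d).
Proof.
case: X_regular X_derive => q10 q20 u0 v0 [[dq1 dp1 dq2 dp2] du dv].
rewrite /gaugeE; by_derive_rules; first by rewrite mulf_neq0.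
by rewrite /dgaugeE /gaugeE; field; rewrite q10 thi_neq.
Qed.

Lemma is_derive_poleCol :
  mx_is_derive t (fun s => poleCol thi1 thi2 (X s)) (dpoleCol thi1 thi2 (X t) d).
Proof.
have dE := is_derive_gaugeE.
case: X_regular X_derive => q10 q20 u0 v0 [[dq1 dp1 dq2 dp2] du dv] i j.
rewrite !mxE; under eq_fun do rewrite mxE.
case: i => [[|[|[|//]]] ?] /=.
- exact: is_derive_cst_fun.
- rewrite /poleCol2; by_derive_rules.
  by rewrite /dpoleCol2 /poleCol2; field; rewrite u0.
- rewrite /poleCol3; by_derive_rules.
  by rewrite /dpoleCol3 /poleCol3; field; rewrite v0.
Qed.

Lemma is_derive_poleRow :
  mx_is_derive t (fun s => poleRow thi1 thi2 (X s)) (dpoleRow thi1 thi2 (X t) d).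
Proof.
have dE := is_derive_gaugeE.
case: X_regular X_derive => q10 q20 u0 v0 [[dq1 dp1 dq2 dp2] du dv] i j.
rewrite !mxE; under eq_fun do rewrite mxE.
case: j => [[|[|[|//]]] ?] /=; by_derive_rules.
- by ring.
- by field; rewrite q10 q20.
- by field; rewrite q20.
Qed.

Lemma is_derive_poleCoef :
  mx_is_derive t (fun s => poleCoef thi1 thi2 (X s)) (dpoleCoef thi1 thi2 (X t) d).
Proof.
move=> i j; rewrite mxE [X in is_derive _ _ _ (X + _)]mxE.
rewrite [X in is_derive _ _ _ (_ + X)]mxE !big_ord1.
under eq_fun do rewrite mxE big_ord1.
have dcol := is_derive_poleCol i 0; have drow := is_derive_poleRow 0 j.
by by_derive_rules; ring.
Qed.

Lemma is_derive_residue2 :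
  is_derive t 1 (fun s => residue2 th01 thi2 thi3 (X s)) (dresidue2 th01 thi2 thi3 (X t) d).
Proof.
case: X_derive => [[dq1 dp1 dq2 dp2] du dv].
rewrite /residue2; by_derive_rules.
by rewrite /dresidue2; ring.
Qed.

Lemma is_derive_residue3 :
  is_derive t 1 (fun s => residue3 th01 thi1 thi2 thi3 (X s))
    (dresidue3 th01 thi1 thi2 thi3 (X t) d).
Proof.
have dE := is_derive_gaugeE; have dl := is_derive_residue2.
case: X_derive => [[dq1 dp1 dq2 dp2] du dv].
rewrite /residue3; by_derive_rules.
by rewrite /dresidue3; ring.
Qed.

Lemma is_derive_residue :
  mx_is_derive t (fun s => residue th01 thi1 thi2 thi3 (X s))
    (dresidue th01 thi1 thi2 thi3 (X t) d).
Proof.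
have dE := is_derive_gaugeE; have dl2 := is_derive_residue2.
have dl3 := is_derive_residue3.
case: X_regular X_derive => q10 q20 u0 v0 [[dq1 dp1 dq2 dp2] du dv] i j.
rewrite !mxE; under eq_fun do rewrite mxE.
case: i j => [[|[|[|//]]] ?] [[|[|[|//]]] ?] /=;
  try exact: is_derive_cst_fun; by_derive_rules.
- by ring.
- by [].
- by field; rewrite u0.
- by field; rewrite v0.
Qed.
End AlongCurve.

(** * The zero-curvature condition in normal form *)

Section Curve.
Variables q1 p1 q2 p2 u v : K -> K.
Let X s := Phase (q1 s) (p1 s) (q2 s) (p2 s) (u s) (v s).
Let N s := poleCoef thi1 thi2 (X s).
Let L s := residue th01 thi1 thi2 thi3 (X s).

Lemma laxA_gauge t y : regular (X t) ->
  laxA th01 thi1 thi2 thi3 q1 p1 q2 p2 u v t y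
  = (t * (y ^+ 2)^-1) *: N t + y^-1 *: L t + infCoef K.
Proof.
move=> Xreg; have [_ _ u0 v0] := Xreg.
apply: conj_eq; first exact: (gaugeG_unit thi1 thi2 (x := X t)).
rewrite !mulmxDl !mulmxDr -!scalemxAl -!scalemxAr.
rewrite (hatA0m1_gauge thi_neq t Xreg) (hatA00_gauge th01 thi3 thi_neq Xreg).
by rewrite (hatAinf_gauge thi1 thi2 (X t)) -scalemxAr scalerA mulrC.
Qed.

Lemma laxB_gauge t y : t != 0 -> regular (X t) ->
  laxB thi1 thi2 q1 p1 q2 p2 u v t y = - y^-1 *: N t.
Proof.
move=> t0 Xreg; have [_ _ u0 v0] := Xreg.
rewrite /laxB (conj_eq _ (hatA0m1_gauge thi_neq t Xreg)); last exact: gaugeG_unit.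
by rewrite scalerA mul1r invfM mulNr mulrAC mulVf // mul1r.
Qed.

(** The t-derivative of t N / x^2 is N / x^2 + t N' / x^2; its first term is
    cancelled by dB/dx = N / x^2, and the x^-3 term of [A, B] is a multiple of
    [N, N] = 0.  Only x^-2 and x^-1 remain. *)
Lemma curvature_expansion (D : set K) (t y : K) (d : phase K) :
  open D -> D t -> t != 0 -> y != 0 ->
  (forall s, D s -> regular (X s)) ->
  [/\ [/\ is_derive t 1 q1 (cq1 d), is_derive t 1 p1 (cp1 d),
          is_derive t 1 q2 (cq2 d) & is_derive t 1 p2 (cp2 d)],
      is_derive t 1 u (cu d) & is_derive t 1 v (cv d)] ->
  let A := laxA th01 thi1 thi2 thi3 q1 p1 q2 p2 u v in
  let B := laxB thi1 thi2 q1 p1 q2 p2 u v in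
  derive1mx (fun s => A s y) t - derive1mx (fun z => B t z) y
    + (A t y *m B t y - B t y *m A t y)
  = (y ^+ 2)^-1 *: (t *: dpoleCoef thi1 thi2 (X t) d - lie3 (L t) (N t))
    + y^-1 *: (dresidue th01 thi1 thi2 thi3 (X t) d - lie3 (infCoef K) (N t)).
Proof.
move=> Dopen Dt t0 y0 Xreg Xd A B; have regt := Xreg t Dt.
have dA : derive1mx (fun s => A s y) t
  = (y ^+ 2)^-1 *: N t + (t * (y ^+ 2)^-1) *: dpoleCoef thi1 thi2 (X t) d
    + y^-1 *: dresidue th01 thi1 thi2 thi3 (X t) d.
  apply/matrixP => i j; rewrite mxE derive1E.
  have dN := @is_derive_poleCoef X t d regt Xd i j.
  have dL := @is_derive_residue X t d regt Xd i j.
  rewrite (@near_eq_derive _ _ _ _ (fun s : K => s * (y ^+ 2)^-1 * N s i j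
    + y^-1 * L s i j + infCoef K i j)); last first.
    (* The normal form holds at points of D only, hence near t as D is open. *)
    apply: filterS (open_nbhs_nbhs (conj Dopen Dt)) => s Ds.
    by rewrite /A laxA_gauge ?mxE //; exact: Xreg.
  apply: derive_val; by_derive_rules.
  by rewrite !mxE; ring.
have dB : derive1mx (fun z => B t z) y = (y ^+ 2)^-1 *: N t.
  apply/matrixP => i j; rewrite mxE derive1E.
  under eq_fun do rewrite /B laxB_gauge // mxE.
  apply: derive_val; by_derive_rules.
  by rewrite !mxE; field.
rewrite dA dB /A /B laxA_gauge // laxB_gauge // /lie3.
rewrite !mulmxDl !mulmxDr -!scalemxAl -!scalemxAr.
apply/matrixP => i j.
move: (N t *m N t) (L t *m N t) (N t *m L t) (infCoef K *m N t)
  (N t *m infCoef K) => NN LN NL CN NC.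
by rewrite !mxE; field.
Qed.

(** The values at x = 1 and x = -1 separate the two coefficients. *)
Lemma flat_iff (D : set K) (t : K) (d : phase K) : open D -> D t -> t != 0 ->
  (forall s, D s -> regular (X s)) ->
  [/\ [/\ is_derive t 1 q1 (cq1 d), is_derive t 1 p1 (cp1 d),
          is_derive t 1 q2 (cq2 d) & is_derive t 1 p2 (cp2 d)],
      is_derive t 1 u (cu d) & is_derive t 1 v (cv d)] ->
  let A := laxA th01 thi1 thi2 thi3 q1 p1 q2 p2 u v in
  let B := laxB thi1 thi2 q1 p1 q2 p2 u v in
  (forall y, y != 0 ->
    derive1mx (fun s => A s y) t - derive1mx (fun z => B t z) y
    + (A t y *m B t y - B t y *m A t y) = 0) <->
  t *: dpoleCoef thi1 thi2 (X t) d = lie3 (L t) (N t) /\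
  dresidue th01 thi1 thi2 thi3 (X t) d = lie3 (infCoef K) (N t).
Proof.
move=> Dopen Dt t0 Xreg Xd A B.
have expand y (y0 : y != 0) := curvature_expansion Dopen Dt t0 y0 Xreg Xd.
split=> [flat|[e1 e2] y y0]; last first.
  by rewrite expand // e1 e2 !subrr !scaler0 addr0.
have := flat 1 (oner_neq0 _); have := flat (-1).
rewrite oppr_eq0 oner_eq0 => /(_ isT).
rewrite !expand ?oppr_eq0 ?oner_eq0 // sqrrN expr1n invrN invr1 scaleN1r !scale1r.
set P := t *: _ - _; set Q := dresidue _ _ _ _ _ _ - _ => /subr0_eq PQ.
rewrite PQ -mulr2n -scaler_nat => /eqP; rewrite scaler_eq0 pnatr_eq0 /= => /eqP Q0.
by split; apply: subr0_eq; rewrite -/P -/Q ?PQ.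
Qed.
End Curve.

(** * The Hamiltonian system as a vector field *)

Section HamiltonianField.
Let H := Ham th01 thi1 thi2 thi3.

Ltac ham_derivative :=
  rewrite derive1E /H /Ham /tHam /tHIIID6; apply: derive_val;
  by_derive_rules; rewrite /=; ring.

Lemma Ham_dp1 t q1 p1 q2 p2 :
  derive1 (fun p => H t q1 p q2 p2) p1 =
  (2 * p1 * q1 ^+ 2 - (q1 ^+ 2 - (thi3 - thi2) * q1 - t)
   + q2 * (p2 * (q1 + q2) - thi1)) / t.
Proof. by ham_derivative. Qed.

Lemma Ham_dq1 t q1 p1 q2 p2 :
  derive1 (fun q => H t q p1 q2 p2) q1 =
  - (- (2 * p1 ^+ 2 * q1 - (2 * q1 - (thi3 - thi2)) * p1 + (th01 + thi2)
      + p1 * q2 * p2) / t).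
Proof. by ham_derivative. Qed.

Lemma Ham_dp2 t q1 p1 q2 p2 :
  derive1 (fun p => H t q1 p1 q2 p) p2 =
  (2 * p2 * q2 ^+ 2 - (q2 ^+ 2 - (thi3 - thi1) * q2 - t)
   + p1 * q2 * (q1 + q2)) / t.
Proof. by ham_derivative. Qed.

Lemma Ham_dq2 t q1 p1 q2 p2 :
  derive1 (fun q => H t q1 p1 q p2) q2 =
  - (- (2 * p2 ^+ 2 * q2 - (2 * q2 - (thi3 - thi1)) * p2 + thi1
      + p1 * (p2 * (q1 + q2) - thi1) + p1 * q2 * p2) / t).
Proof. by ham_derivative. Qed.

Lemma hamField_iff t x d : t != 0 -> regular x ->
  [/\ cq1 d = derive1 (fun p => H t (cq1 x) p (cq2 x) (cp2 x)) (cp1 x),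
      cp1 d = - derive1 (fun q => H t q (cp1 x) (cq2 x) (cp2 x)) (cq1 x),
      cq2 d = derive1 (fun p => H t (cq1 x) (cp1 x) (cq2 x) p) (cp2 x) &
      cp2 d = - derive1 (fun q => H t (cq1 x) (cp1 x) q (cp2 x)) (cq2 x)] /\
  (t * cq1 x / cu x * cu d = cq2 x * (cp2 x * cq2 x - thi1) + t /\
   1 / cv x * cv d = 1 / cq2 x)
  <-> d = hamField th01 thi1 thi2 thi3 t x.
Proof.
case: x d => q1 p1 q2 p2 u v [dq1 dp1 dq2 dp2 du dv] t0 [/= q10 q20 u0 v0].
rewrite Ham_dp1 Ham_dq1 Ham_dp2 Ham_dq2 !opprK.
split=> [[[-> -> -> ->] [uE vE]]|[-> -> -> -> -> ->]].
  congr Phase; first by rewrite -uE; field; rewrite t0 q10 u0.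
  by rewrite -[v / q2]/(v * q2^-1) -(mul1r q2^-1) -vE; field.
by split=> //; split; field; rewrite ?t0 ?q10 ?q20 ?u0 ?v0.
Qed.
End HamiltonianField.
End Curves.

(** * The equivalence *)

Theorem zero_curvature_hamiltonian (K : numFieldType) (th01 thi1 thi2 thi3 : K)
    (D : set K) (q1 p1 q2 p2 u v : K -> K) :
  th01 != 0 -> thi1 != thi2 -> open D -> D `<=` [set t | t != 0] ->
  [/\ holomorphic_on D q1, holomorphic_on D p1, holomorphic_on D q2
    & holomorphic_on D p2] ->
  holomorphic_on D u /\ holomorphic_on D v ->
  (forall t, D t -> [/\ q1 t != 0, q2 t != 0, u t != 0 & v t != 0]) ->
  zero_curvature D (laxA th01 thi1 thi2 thi3 q1 p1 q2 p2 u v)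
                   (laxB thi1 thi2 q1 p1 q2 p2 u v)
  <->
  (hamiltonian_system D (Ham th01 thi1 thi2 thi3) q1 p1 q2 p2 /\
   gauge_equations D thi1 q1 q2 p2 u v).
Proof.
move=> th010; rewrite eq_sym -subr_eq0 => thi_neq Dopen D0.
move=> [hq1 hp1 hq2 hp2] [hu hv] nz.
pose X s := Phase (q1 s) (p1 s) (q2 s) (p2 s) (u s) (v s).
have Xreg s : D s -> regular (X s) by exact: nz.
pose X' s : phase K := Phase (derive1 q1 s) (derive1 p1 s) (derive1 q2 s) (derive1 p2 s)
  (derive1 u s) (derive1 v s).
have pointwise t : D t ->
  (forall y, y != 0 ->
    derive1mx (fun s => laxA th01 thi1 thi2 thi3 q1 p1 q2 p2 u v s y) t
    - derive1mx (fun z => laxB thi1 thi2 q1 p1 q2 p2 u v t z) y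
    + (laxA th01 thi1 thi2 thi3 q1 p1 q2 p2 u v t y
         *m laxB thi1 thi2 q1 p1 q2 p2 u v t y
       - laxB thi1 thi2 q1 p1 q2 p2 u v t y
         *m laxA th01 thi1 thi2 thi3 q1 p1 q2 p2 u v t y) = 0)
  <-> X' t = hamField th01 thi1 thi2 thi3 t (X t).
  move=> Dt; have t0 : t != 0 := D0 t Dt.
  rewrite -(flow_unique thi3 thi_neq (X' t) th010 t0 (Xreg t Dt)).
  apply: (@flat_iff K th01 thi1 thi2 thi3 thi_neq q1 p1 q2 p2 u v D t (X' t)) => //.
  by (split; first split); rewrite /= derive1E; apply: derivableP; auto.
have hamX' t (Dt : D t) :=
  @hamField_iff K th01 thi1 thi2 thi3 t (X t) (X' t) (D0 t Dt) (Xreg t Dt).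
split=> [flat|[ham gau] t y Dt].
  have sol t (Dt : D t) :=
    (hamX' t Dt).2 ((pointwise t Dt).1 (fun y y0 => flat t y Dt y0)).
  by split=> t Dt; have [] := sol t Dt.
move: y; apply/(pointwise t Dt)/(hamX' t Dt).
by split; [exact: ham | exact: gau].
Qed.

Theorem mainTheorem10 (R : realType)
    (th01 th02 thi1 thi2 thi3 : R[i])
    (D : set R[i]) (q1 p1 q2 p2 u v : R[i] -> R[i]) :
  th01 + th02 + thi1 + thi2 + thi3 = 0 ->
  th01 != 0 ->
  thi1 != thi2 ->
  is_domain D ->
  D `<=` [set t | t != 0] ->
  [/\ holomorphic_on D q1, holomorphic_on D p1, holomorphic_on D q2
    & holomorphic_on D p2] ->
  holomorphic_on D u /\ holomorphic_on D v ->
  (forall t, D t -> [/\ q1 t != 0, q2 t != 0, u t != 0 & v t != 0]) ->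
  zero_curvature D (laxA th01 thi1 thi2 thi3 q1 p1 q2 p2 u v)
                   (laxB thi1 thi2 q1 p1 q2 p2 u v)
  <->
  (hamiltonian_system D (Ham th01 thi1 thi2 thi3) q1 p1 q2 p2 /\
   gauge_equations D thi1 q1 q2 p2 u v).
Proof.
move=> _ th010 thi_neq [_ Dopen _] D0 hqp huv nz.
exact: zero_curvature_hamiltonian.
Qed.
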